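(* Let $(a_n)_{n\ge 1}$ be a sequence with $a_n>0$ for all $n$. For $-1\le p<0$, $$\sum_{n=1}^{\infty}\Big(\ln\Big(\frac{n+1}{n}\Big)\sum_{k=1}^{n}a_k\Big)^p\ \le\ \Big(\frac{p}{p-1}\Big)^p\sum_{n=1}^{\infty}a_n^p .$$ The constant $\big(p/(p-1)\big)^p$ is best possible.
   Context: All sums have nonnegative terms and take values in $[0,+\infty]$. ''Best possible'' means that, for the given $p$, the constant cannot be replaced by a smaller one so that the inequality still holds for all positive sequences $(a_n)$. *)

(* Defs.v *)
From mathcomp Require Import all_boot all_order all_algebra.
From mathcomp Require Import all_classical all_reals all_analysis.

Set Implicit Arguments.
Unset Strict Implicit.
Unset Printing Implicit Defensive.

Import Order.TTheory GRing.Theory Num.Theory.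
Import numFieldNormedType.Exports.

Local Open Scope ring_scope.

(* Sequences (a_n)_{n >= 1} are functions on nat whose value at 0 is
   unconstrained and never used.  Both series are sums in \bar R, so they may
   be +oo; the powers are real powers of positive reals. *)
Definition log_mean_ineq (R : realType) (p C : R) : Prop :=
  forall a : nat -> R, (forall n : nat, (1 <= n)%N -> 0 < a n) ->
    (\sum_(1 <= n <oo)
        ((ln (n.+1%:R / n%:R) * \sum_(1 <= k < n.+1) a k) `^ p)%:E
     <= C%:E * \sum_(1 <= n <oo) ((a n) `^ p)%:E)%E.

(* Main.v *)
(* Write [q = - p], [r = q / (1 + q)] and [L n = ln ((n + 1) / n)].  By Radon's
   inequality (Jensen for [t ^ (1 + q)] in two terms), with [A n] the partial sums
   of [a] and [x = r n],
     (x + 1) ^ (1 + q) * A (n + 1) ^ (- q)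
       <= x ^ (1 + q) * A n ^ (- q) + a (n + 1) ^ (- q),
   so the inequality follows by telescoping once
     L (n + 1) ^ (- q)
       <= r ^ (- q) * ((r n + 1) ^ (1 + q) - (r (n + 1)) ^ (1 + q)).
   For [N = n + 1] this says that the mean of [t ^ q] for [t] from [N] to [N + 1 / q]
   is at least [L N ^ (- q)].  As [t ^ q] is a convex function of [1 / t], it lies
   above its tangent at [1 / t = L N]; integrating the tangent suffices because
   [ln (N + 1 / q) - ln N <= L N / q], which uses [q <= 1].
   Sharpness: for [a n = n ^ (1 / q)] the left-hand terms are [r ^ (- q) / n] up to
   a summable error, while [a n ^ (- q) = 1 / n]. *)
Require Import Defs.
From mathcomp Require Import all_boot all_order all_algebra.
From mathcomp Require Import all_classical all_reals all_analysis.
From mathcomp Require Import ring lra.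
Import Order.TTheory GRing.Theory Num.Theory.
Import numFieldNormedType.Exports.
Local Open Scope ring_scope.

(** * Tangent-line inequalities for real powers *)

(** The left side is the tangent at [s] of [x ^ q] seen as a function of [1 / x]. With [y = s / x],
    [exp (- q ln y) >= 1 - q ln y >= 1 - q (y - 1)]. *)
Lemma powR_ge_tangent_inv (R : realType) (q x s : R) :
  0 <= q -> 0 < x -> 0 < s -> s `^ q * (1 + q - q * (s / x)) <= x `^ q.
Proof.
move=> q0 x0 s0; have y0 : 0 < s / x by rewrite divr_gt0.
have xE : x = s * (s / x)^-1 by rewrite invf_div mulrCA mulfV ?mulr1// gt_eqF.
rewrite [in leRHS]xE powRM ?invr_ge0 ?(ltW s0) ?(ltW y0)//.
rewrite ler_pM2l ?powR_gt0//.
rewrite /powR gt_eqF ?invr_gt0//; apply: le_trans (expR_ge1Dx _).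
rewrite lnV ?posrE// mulrN -addrA lerD2l -{1}(mulr1 q) -mulrBr.
rewrite -mulrN ler_wpM2l// lerNr opprB.
by have := @le_ln1Dx _ (s / x - 1); rewrite addrCA subrr addr0; apply; lra.
Qed.

Lemma powR_ge_bernoulli (R : realType) (r t : R) :
  1 <= r -> 0 < t -> 1 + r * (t - 1) <= t `^ r.
Proof.
move=> r1 t0; have q0 : 0 <= r - 1 by rewrite subr_ge0.
have -> : t `^ r = t * t `^ (r - 1).
  by rewrite -[in LHS](subrKC 1 r) [LHS]powRD ?(gt_eqF t0) ?implybT ?powRr1 ?(ltW t0).
have := powR_ge_tangent_inv _ _ _ _ q0 t0 ltr01.
rewrite powR1 !mul1r -(ler_pM2l t0) => /(le_trans _); apply.
by rewrite le_eqVlt; apply/orP; left; apply/eqP; field; rewrite gt_eqF.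
Qed.

(** After exponentiation this is Bernoulli: [1 + s / a <= (1 + 1 / a) ^ s]. *)
Lemma ln_incr_le (R : realType) (a s : R) :
  0 < a -> 1 <= s -> ln (a + s) - ln a <= s * ln ((a + 1) / a).
Proof.
move=> a0 s1; have t0 : 0 < (a + 1) / a by rewrite divr_gt0// addr_gt0.
have as0 : 0 < a + s by lra.
have a10 : 0 < a + 1 by lra.
rewrite -ln_div ?posrE// -ln_powR ler_ln ?posrE ?powR_gt0 ?divr_gt0//.
apply: le_trans (powR_ge_bernoulli _ _ _ s1 t0); rewrite le_eqVlt; apply/orP; left.
by apply/eqP; field; lra.
Qed.

Lemma powR_incr_ge (R : realType) (q a s : R) :
  0 < q -> 0 < a -> 1 <= s ->
  (1 + q) * s * (ln ((a + 1) / a)) `^ (- q) <= (a + s) `^ (1 + q) - a `^ (1 + q).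
Proof.
move=> q0 a0 s1; set L := ln _.
have L0 : 0 < L by rewrite ln_gt0// ltr_pdivlMr//; lra.
(* The subtracted function is a primitive of [1 + q] times the tangent minorant of [t ^ q] at
   [1 / t = L]. Monotonicity of [f] thus replaces integration of the tangent inequality. *)
pose f := (powR (R:=R))^~ (1 + q) -
  (((1 + q) * L^-1 `^ q) \*: (((1 + q) \*: id) - ((q / L) \*: @ln R)))  : R -> R.
have fD (x : R) : 0 < x -> is_derive x 1 f
   ((1 + q) * x `^ (1 + q - 1) - ((1 + q) * L^-1 `^ q) * ((1 + q) - (q / L) * x^-1)).
  move=> x0.
  have ? := is_derive1_ln x0.
  have ? := is_derive1_powR (1 + q) x0.
  by apply: is_derive_eq; rewrite /GRing.scale/= ?mulr1.
have : f a <= f (a + s).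
  have h0 x : x \in `]a / 2, a + s + 1[ -> 0 < x.
    by rewrite in_itv/= => /andP[ax _]; lra.
  apply: (@ger0_derive1_le_oo _ f (a / 2) (a + s + 1)).
  - by move=> x /h0 /fD[].
  - move=> x /h0 x0; rewrite derive1E; have [_ ->] := fD _ x0.
    rewrite -mulrA -mulrBr mulr_ge0 ?subr_ge0//; first lra.
    rewrite [1 + q - 1]addrC addKr.
    rewrite -mulrA; apply: powR_ge_tangent_inv => //; first exact: ltW.
    by rewrite invr_gt0.
  - move=> x; rewrite inE/= => /h0 /fD[/derivable1_diffP + _].
    exact: differentiable_continuous.
  - by rewrite in_itv/=; lra.
  - by rewrite in_itv/=; lra.
  - lra.
rewrite /f !fctE /= /GRing.scale/= => fa.
have LV : L^-1 `^ q = L `^ (- q).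
  by rewrite -powR_inv1 ?(ltW L0)// -powRrM mulN1r.
rewrite LV in fa.
have := ln_incr_le _ _ _ a0 s1; rewrite -/L => lnL.
set K := L `^ (- q) in fa *; have K0 : 0 < K by rewrite powR_gt0.
have {}lnL : q / L * (ln (a + s) - ln a) <= q * s.
  by rewrite -mulrA ler_pM2l// ler_pdivrMl// mulrC.
have : (1 + q) * K * (q / L * (ln (a + s) - ln a)) <= (1 + q) * K * (q * s).
  by rewrite ler_wpM2l// mulr_ge0//; lra.
lra.
Qed.

(** * Radon's inequality and the telescoping argument *)

Lemma powR_perspective (R : realType) (q x y : R) :
  0 < x -> 0 < y -> x `^ (1 + q) * y `^ (- q) = x * (x / y) `^ q.
Proof.
move=> x0 y0; rewrite powRD ?(gt_eqF x0) ?implybT// powRr1 ?ltW//.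
by rewrite powRM ?invr_ge0 ?ltW// -powR_inv1 ?ltW// -powRrM mulN1r mulrA.
Qed.

Lemma radon_le (R : realType) (q x y a : R) :
  0 < q -> 0 < x -> 0 < y -> 0 < a ->
  (x + 1) `^ (1 + q) * (y + a) `^ (- q) <= x `^ (1 + q) * y `^ (- q) + a `^ (- q).
Proof.
move=> q0 x0 y0 a0; have -> : a `^ (- q) = 1 `^ (1 + q) * a `^ (- q).
  by rewrite powR1 mul1r.
rewrite !powR_perspective ?addr_gt0//.
(* Both ratios [x / y] and [1 / a] are compared with the tangent at their mediant [s]; the two
   weighted tangents add up to [s ^ q * (x + 1)]. *)
set s := (x + 1) / (y + a).
have s0 : 0 < s by rewrite divr_gt0// addr_gt0.
have term (u v : R) : 0 < u -> 0 < v ->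
    s `^ q * ((1 + q) * u - q * s * v) <= u * (u / v) `^ q.
  move=> u0 v0; have /(ler_wpM2l (ltW u0)) :=
    powR_ge_tangent_inv _ _ _ _ (ltW q0) (divr_gt0 u0 v0) s0.
  apply: le_trans; rewrite le_eqVlt; apply/orP; left; apply/eqP.
  by field; rewrite !gt_eqF.
apply: le_trans (lerD (term _ _ x0 y0) (term _ _ ltr01 a0)).
rewrite -mulrDr mulrC ler_pM2l ?powR_gt0// le_eqVlt; apply/orP; left; apply/eqP.
by rewrite /s; field; rewrite gt_eqF// addr_gt0.
Qed.

Lemma hardy_weight_le (R : realType) (q : R) (n : nat) : 0 < q -> q <= 1 ->
  ln (n.+2%:R / n.+1%:R) `^ (- q) <= (q / (1 + q)) `^ (- q) *
  ((q / (1 + q) * n%:R + 1) `^ (1 + q) - (q / (1 + q) * n.+1%:R) `^ (1 + q)).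
Proof.
move=> q0 q1; set r := q / (1 + q).
have r0 : 0 < r by rewrite divr_gt0//; lra.
(* Since [1 / r = 1 + 1 / q], factoring out [r] leaves an increment of length [1 / q], which is at
   least [1]. *)
have -> : r * n%:R + 1 = r * (n.+1%:R + q^-1).
  by rewrite -natr1 /r; field; rewrite !gt_eqF//; lra.
have n0 : 0 < n.+1%:R :> R by rewrite ltr0n.
rewrite !(@powRM _ r) ?(ltW r0) ?(ltW n0) ?addr_ge0 ?invr_ge0 ?(ltW q0) ?(ltW n0)//.
rewrite -mulrBr mulrA -powRD ?(gt_eqF r0) ?implybT//.
rewrite addrCA addNr addr0 powRr1 ?(ltW r0)// -natr1.
have := @powR_incr_ge _ q n.+1%:R q^-1 q0 n0.
rewrite invf_ge1// => /(_ q1) /(ler_wpM2l (ltW r0)); apply: le_trans.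
rewrite le_eqVlt; apply/orP; left; apply/eqP; rewrite /r -!natr1.
by field; rewrite !gt_eqF//; lra.
Qed.

(** The second summand on the left is the Radon term carried from [n] to [n + 1]; it makes the
    induction close. *)
Lemma log_mean_partial_sum_le (R : realType) (q : R) (a : nat -> R) (n : nat) :
  0 < q -> q <= 1 -> (forall k, (1 <= k)%N -> 0 < a k) ->
  \sum_(1 <= k < n.+1) (ln (k.+1%:R / k%:R) * \sum_(1 <= j < k.+1) a j) `^ (- q)
    + (q / (1 + q)) `^ (- q) * ((q / (1 + q) * n%:R) `^ (1 + q) *
        (\sum_(1 <= j < n.+1) a j) `^ (- q))
  <= (q / (1 + q)) `^ (- q) * \sum_(1 <= k < n.+1) a k `^ (- q).
Proof.
move=> q0 q1 apos; set r := q / (1 + q).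
have r0 : 0 < r by rewrite divr_gt0//; lra.
have A0 k : 0 < \sum_(1 <= j < k.+2) a j.
  rewrite big_nat_recl//= ltr_pwDl ?apos// big_nat_cond sumr_ge0// => i.
  by move=> /andP[/andP[i1 _] _]; rewrite ltW ?apos.
elim: n => [|n IH].
  have z : (0 : R) `^ (1 + q) = 0 by rewrite powR0// gt_eqF//; lra.
  by rewrite !big_geq// mulr0 z mul0r !mulr0 addr0.
rewrite !(@big_nat_recr _ _ _ n.+1)//=.
set S := \sum_(1 <= i < n.+1) _ in IH *.
set A := \sum_(1 <= i < n.+1) a i in IH *.
set X := \sum_(1 <= i < n.+1) a i `^ (- q) in IH *.
have an0 : 0 < a n.+1 by rewrite apos.
have AS : 0 < A + a n.+1 by have := A0 n; rewrite (@big_nat_recr _ _ _ n.+1).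
have L0 : 0 <= ln (n.+2%:R / n.+1%:R : R).
  by rewrite ln_ge0// ler_pdivlMr ?ltr0n// mul1r ler_nat.
have C0 : 0 < r `^ (- q) by rewrite powR_gt0.
rewrite powRM ?(ltW AS)//.
have rad : (r * n%:R + 1) `^ (1 + q) * (A + a n.+1) `^ (- q) <=
    (r * n%:R) `^ (1 + q) * A `^ (- q) + a n.+1 `^ (- q).
  (* For [n = 0] the sum [A] is empty, so Radon's inequality does not apply; nonnegativity of its
     first right-hand term suffices. *)
  have [n0|n0] := posnP n.
    rewrite /A n0 big_geq// mulr0 !add0r powR1 mul1r lerDr.
    by rewrite mulr_ge0 ?powR_ge0.
  apply: radon_le => //; first by rewrite mulr_gt0// ltr0n.
  by rewrite /A -(prednK n0) A0.
have := hardy_weight_le _ _ n q0 q1; rewrite -/r.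
move/(ler_wpM2r (powR_ge0 (A + a n.+1) (- q))).
have := ler_wpM2l (ltW C0) rad.
lra.
Qed.

Lemma log_mean_ineq_const (R : realType) (q : R) : 0 < q -> q <= 1 ->
  log_mean_ineq (- q) ((q / (1 + q)) `^ (- q)).
Proof.
move=> q0 q1 a apos.
have term0 n : (0 <= (a n `^ (- q))%:E)%E by rewrite lee_fin powR_ge0.
apply: lime_le.
  by apply: is_cvg_nneseries => n _ _; rewrite lee_fin powR_ge0.
near=> n.
have n0 : (0 < n)%N by near: n; exists 1%N.
apply: (@le_trans _ _ (((q / (1 + q)) `^ (- q))%:E *
    \sum_(1 <= k < n) (a k `^ (- q))%:E)%E); last first.
  apply: lee_wpmul2l; first by rewrite lee_fin powR_ge0.
  by apply: nneseries_lim_ge.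
rewrite -(prednK n0) !sumEFin -EFinM lee_fin.
apply: le_trans (log_mean_partial_sum_le _ _ _ n.-1 q0 q1 apos).
by rewrite lerDl mulr_ge0 ?mulr_ge0 ?powR_ge0.
Unshelve. all: by end_near. Qed.

(** * Sharpness of the constant *)

Lemma sum_powR_le (R : realType) (s : R) (n : nat) : 0 < s ->
  \sum_(1 <= k < n.+1) k%:R `^ s <= n.+1%:R `^ (1 + s) / (1 + s).
Proof.
move=> s0; have s10 : 0 < 1 + s by lra.
elim: n => [|n IH].
  by rewrite big_geq// divr_ge0 ?powR_ge0// ltW.
rewrite big_nat_recr//=; apply: (le_trans (lerD IH (lexx _))).
have n0 : 0 < n.+1%:R :> R by rewrite ltr0n.
have t0 : 0 < n.+2%:R / n.+1%:R :> R by rewrite divr_gt0// ltr0n.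
have s1 : 1 <= 1 + s by lra.
have nE : n.+2%:R `^ (1 + s) = n.+1%:R `^ (1 + s) * (n.+2%:R / n.+1%:R) `^ (1 + s) :> R.
  by rewrite -powRM ?ltW// mulrC divfK// gt_eqF.
rewrite nE.
have := powR_ge_bernoulli _ _ _ s1 t0; rewrite -(ler_pM2l (powR_gt0 (1 + s) n0)).
move=> h; rewrite ler_pdivlMr//; apply: le_trans h.
have -> : n.+1%:R `^ (1 + s) = n.+1%:R * n.+1%:R `^ s :> R.
  by rewrite powRD ?powRr1 ?ltW// gt_eqF// implybT.
rewrite le_eqVlt; apply/orP; left; apply/eqP.
by rewrite -[n.+2%:R]natr1; field; rewrite !gt_eqF.
Qed.

Lemma ler_powRN (R : realType) (q x y : R) :
  0 <= q -> 0 < x -> x <= y -> y `^ (- q) <= x `^ (- q).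
Proof.
move=> q0 x0 xy; have y0 := lt_le_trans x0 xy.
rewrite !powRN lef_pV2 ?posrE ?powR_gt0//.
by rewrite ge0_ler_powR// nnegrE ltW.
Qed.

(** The error is written as a difference so that it telescopes when summed. With [N = n + 1], the
    estimates leave [N / (N + 1) ^ 2], which exceeds the required value by [1 / (N (N + 1) ^ 2)]. *)
Lemma log_mean_powR_ge (R : realType) (q : R) (n : nat) : 0 < q -> q <= 1 ->
  (q / (1 + q)) `^ (- q) * (n.+1%:R^-1 - 2 * (n.+1%:R^-1 - n.+2%:R^-1)) <=
  (ln (n.+2%:R / n.+1%:R) * \sum_(1 <= k < n.+2) k%:R `^ q^-1) `^ (- q).
Proof.
move=> q0 q1; set r := q / (1 + q).
have r0 : 0 < r by rewrite divr_gt0//; lra.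
have n1 : 0 < n.+1%:R :> R by rewrite ltr0n.
have n2 : 0 < n.+2%:R :> R by rewrite ltr0n.
have A0 : 0 < \sum_(1 <= k < n.+2) k%:R `^ q^-1 :> R.
  rewrite big_nat_recl//=; apply: ltr_pwDl; first by rewrite powR_gt0.
  by apply: sumr_ge0 => i _; exact: powR_ge0.
have L0 : 0 < ln (n.+2%:R / n.+1%:R : R).
  by rewrite ln_gt0// ltr_pdivlMr// mul1r ltr_nat.
have Ln : ln (n.+2%:R / n.+1%:R) <= n.+1%:R^-1 :> R.
  have -> : n.+2%:R / n.+1%:R = 1 + n.+1%:R^-1 :> R.
    by rewrite -[n.+2%:R]natr1 mulrDl divff ?gt_eqF// mul1r.
  by apply: le_ln1Dx; apply: lt_trans (_ : 0 < _); rewrite ?invr_gt0// ltrN10.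
have qV0 : 0 < q^-1 by rewrite invr_gt0.
have := ler_pM (ltW L0) (ltW A0) Ln (sum_powR_le _ _ n.+1 qV0).
move=> /(ler_powRN _ _ _ _ (ltW q0) (mulr_gt0 L0 A0)); apply: le_trans.
have -> : n.+1%:R^-1 * (n.+2%:R `^ (1 + q^-1) / (1 + q^-1)) =
    r * (n.+2%:R * n.+2%:R `^ q^-1 / n.+1%:R) :> R.
  rewrite powRD ?powRr1 ?(ltW n2) ?(gt_eqF n2) ?implybT// /r.
  by field; rewrite !gt_eqF//; lra.
rewrite (@powRM _ r) ?(ltW r0)//.
rewrite ler_pM2l ?powR_gt0//.
have -> : n.+2%:R * n.+2%:R `^ q^-1 / n.+1%:R =
    n.+2%:R `^ q^-1 * (n.+2%:R / n.+1%:R) :> R by field; rewrite gt_eqF.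
rewrite powRM ?powR_ge0 ?divr_ge0 ?(ltW n1) ?(ltW n2)// -powRrM.
rewrite mulrN mulVf ?gt_eqF// powR_inv1 ?(ltW n2)//.
have : (n.+2%:R / n.+1%:R) `^ (- 1) <= (n.+2%:R / n.+1%:R) `^ (- q) :> R.
  by rewrite ler_powR ?lerN2// ler_pdivlMr// mul1r ler_nat.
rewrite powR_inv1 ?divr_ge0 ?(ltW n1) ?(ltW n2)// => h.
have n2V : 0 <= n.+2%:R^-1 :> R by rewrite invr_ge0 ltW.
apply: le_trans (ler_wpM2l n2V h).
rewrite -subr_ge0.
have -> : n.+2%:R^-1 * (n.+2%:R / n.+1%:R)^-1 -
    (n.+1%:R^-1 - 2 * (n.+1%:R^-1 - n.+2%:R^-1)) = (n.+1%:R * n.+2%:R ^+ 2)^-1 :> R.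
  by rewrite -[n.+2%:R]natr1; field; rewrite !gt_eqF//; lra.
by rewrite invr_ge0 mulr_ge0 ?exprn_ge0// ltW.
Qed.

Lemma log_mean_powR_sum_ge (R : realType) (q : R) (n : nat) : 0 < q -> q <= 1 ->
  (q / (1 + q)) `^ (- q) * (\sum_(1 <= k < n.+1) k%:R^-1 - 2) <=
  \sum_(1 <= k < n.+1)
    (ln (k.+1%:R / k%:R) * \sum_(1 <= j < k.+1) j%:R `^ q^-1) `^ (- q).
Proof.
move=> q0 q1; set C := _ `^ (- q).
have C0 : 0 <= C by rewrite powR_ge0.
(* The induction needs the exact telescoped error, not its bound [2]. *)
suff h : C * (\sum_(1 <= k < n.+1) k%:R^-1 - 2 * (1 - n.+1%:R^-1)) <=
    \sum_(1 <= k < n.+1)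
      (ln (k.+1%:R / k%:R) * \sum_(1 <= j < k.+1) j%:R `^ q^-1) `^ (- q).
  apply: le_trans h; rewrite ler_wpM2l// lerD2l lerN2.
  by rewrite -[leRHS]mulr1 ler_wpM2l// gerBl invr_ge0.
elim: n => [|n IH]; first by rewrite !big_geq// invr1 subrr mulr0 subrr mulr0.
rewrite [leRHS]big_nat_recr//= [X in C * (X - _)]big_nat_recr//=.
apply: le_trans (lerD IH (log_mean_powR_ge _ _ n q0 q1)); rewrite -/C -mulrDr.
by rewrite le_eqVlt; apply/orP; left; apply/eqP; congr (_ * _); ring.
Qed.

Lemma harmonic_sum_unbounded (R : realType) (M : R) :
  exists n : nat, M < \sum_(1 <= k < n.+1) k%:R^-1.
Proof.
apply: contrapT => H; apply: (@dvg_harmonic R).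
apply: nondecreasing_is_cvgn.
  by apply/nondecreasing_series => i _ _; rewrite invr_ge0.
exists M => _ [n _ <-]; rewrite /series/= leNgt; apply/negP => Mn.
by apply: H; exists n; rewrite big_add1.
Qed.

(* The hypothesis is applied to the sequence equal to [a] up to [N] and to
   [2 ^ ((n + 1) / q)] afterwards, whose negative powers past [N] add up to at most [1]. *)
Lemma log_mean_ineq_truncated (R : realType) (q C : R) (a : nat -> R) (N : nat) :
  0 < q -> 0 <= C -> (forall n, (1 <= n)%N -> 0 < a n) ->
  log_mean_ineq (- q) C ->
  \sum_(1 <= n < N.+1) (ln (n.+1%:R / n%:R) * \sum_(1 <= k < n.+1) a k) `^ (- q)
  <= C * (\sum_(1 <= n < N.+1) a n `^ (- q) + 1).
Proof.
move=> q0 C0 apos H.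
pose b n := if (n < N.+1)%N then a n else (2 ^ n.+1)%:R `^ q^-1.
have bE n : (n < N.+1)%N -> b n = a n by rewrite /b => ->.
have b0 n : (1 <= n)%N -> 0 < b n.
  by rewrite /b => n1; case: ifP => _; [exact: apos|rewrite powR_gt0// ltr0n expn_gt0].
have t0 n : (0 <= (b n `^ (- q))%:E)%E by rewrite lee_fin powR_ge0.
have e0 n : (0 <= (1 / (2 ^ n.+1)%:R : R)%:E)%E by rewrite lee_fin divr_ge0.
rewrite -lee_fin.
have -> : \sum_(1 <= n < N.+1)
      (ln (n.+1%:R / n%:R) * \sum_(1 <= k < n.+1) a k) `^ (- q) =
    \sum_(1 <= n < N.+1)
      (ln (n.+1%:R / n%:R) * \sum_(1 <= k < n.+1) b k) `^ (- q).
  apply: eq_big_nat => n /andP[_ nN]; congr ((_ * _) `^ _).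
  by apply: eq_big_nat => k /andP[_ kn]; rewrite bE// (leq_trans kn nN).
apply: (le_trans _ (le_trans (H b b0) _)).
  rewrite -sumEFin; apply: nneseries_lim_ge => n _ _.
  by rewrite lee_fin powR_ge0.
rewrite EFinM; apply: lee_wpmul2l; first by rewrite lee_fin.
rewrite (nneseries_split 1 N) ?add1n// EFinD -sumEFin; apply: leeD.
  rewrite le_eqVlt; apply/orP; left; apply/eqP.
  by apply: eq_big_nat => n /andP[_ nN]; rewrite bE.
apply: le_trans (@epsilon_trick0 R 1 xpredT ler01).
rewrite [leRHS](nneseries_split 0 N.+1)// add0n.
apply: le_trans (leeDr _ _); last by apply: sume_ge0.
apply: lee_lim.
- exact: is_cvg_nneseries.
- exact: is_cvg_nneseries.
near=> m; rewrite !big_nat; apply: lee_sum => n /andP[Nn _].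
rewrite lee_fin /b ltnNge Nn/= -powRrM mulrN mulVf ?gt_eqF//.
by rewrite powR_inv1 ?div1r.
Unshelve. all: by end_near. Qed.

Lemma log_mean_ineq_const_ge (R : realType) (q C : R) : 0 < q -> q <= 1 ->
  0 <= C -> log_mean_ineq (- q) C -> (q / (1 + q)) `^ (- q) <= C.
Proof.
move=> q0 q1 C0 H; set D := _ `^ (- q).
rewrite leNgt; apply/negP => CD.
(* The truncated inequality will give [D * (h - 2) <= C * (h + 1)], which fails once [h] passes this
   threshold. *)
have [N] := harmonic_sum_unbounded R ((2 * D + C) / (D - C)).
rewrite ltr_pdivrMr ?subr_gt0//; set h := \sum_(_ <= _ < _) _ => hN.
have a0 n : (1 <= n)%N -> 0 < n%:R `^ q^-1 :> R.
  by move=> n1; rewrite powR_gt0// ltr0n.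
have := log_mean_ineq_truncated _ _ _ _ N q0 C0 a0 H.
have -> : \sum_(1 <= n < N.+1) (n%:R `^ q^-1) `^ (- q) = h.
  by apply: eq_bigr => n _; rewrite -powRrM mulrN mulVf ?gt_eqF// powR_inv1.
move/(le_trans (log_mean_powR_sum_ge _ _ N q0 q1)); rewrite -/h -/D.
lra.
Qed.

Theorem corollary1p3 (R : realType) (p : R) (hp1 : -1 <= p) (hp0 : p < 0) :
  log_mean_ineq p ((p / (p - 1)) `^ p) /\
  (forall C : R, C < (p / (p - 1)) `^ p -> ~ log_mean_ineq p C).
Proof.
have [q pE] : exists q, p = - q by exists (- p); rewrite opprK.
have q0 : 0 < q by lra.
have q1 : q <= 1 by lra.
have -> : p / (p - 1) = q / (1 + q) by rewrite pE; field; lra.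
rewrite {}pE; split; first exact: log_mean_ineq_const.
move=> C CD H; have := @powR_gt0 R (q / (1 + q)) (- q).
rewrite divr_gt0 ?addr_gt0// => /(_ isT) D0.
(* Raising [C] to [Num.max C 0] preserves the inequality and covers negative [C]; the maximum is
   still below the positive constant. *)
have : (q / (1 + q)) `^ (- q) <= Num.max C 0.
  apply: log_mean_ineq_const_ge => //; first by rewrite le_max lexx orbT.
  move=> a apos; apply: le_trans (H a apos) _; apply: lee_wpmul2r.
    by apply: nneseries_ge0 => n _ _; rewrite lee_fin powR_ge0.
  by rewrite lee_fin le_max lexx.
by rewrite leNgt gt_max CD D0.
Qed.
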